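(* Let $n\ge 2$, let $G=\langle a,b\mid a^n=b^2=1,\ a^b=a^{-1}\rangle\cong\mathrm{D}_{2n}$, and let $\Gamma=\mathrm{Cay}(G,S)$ be a connected inner-automorphic Cayley graph. Then $\Gamma$ is $2$-distance-transitive if and only if $\Gamma$ is isomorphic to one of the following graphs: (i) $\mathsf{K}_{n,n}\cong\mathrm{Cay}(G,T)$, where either $T=\{a^ib\mid 1\le i\le n\}$, or $n=2k$ is even and $T=\{a^{2i}b,\,a^{2i+1}\mid 1\le i\le k\}$ or $T=\{a^{2i+1}b,\,a^{2i+1}\mid 1\le i\le k\}$; (ii) $\mathsf{K}_{n,n}-n\mathsf{K}_2\cong\mathrm{Cay}(G,T)$, where $n=2k$ with $k\ge 3$ odd, and either $T=\{a^{2i}b,\,a^{2j+1}\mid 1\le i,j\le k,\ 2j+1\ne k\}$ or $T=\{a^{2i+1}b,\,a^{2j+1}\mid 1\le i,j\le k,\ 2j+1\neq k\}$; (iii) $\mathsf{K}_{2n}\cong\mathrm{Cay}(G,G\setminus\{1\})$; (iv) $\mathsf{K}_{m[t]}\cong\mathrm{Cay}(G,G\setminus H)$, where $H$ is the unique subgroup of $\langle a\rangle$ of order $t$, $m\ge 3$, $t\ge 2$ and $mt=2n$.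
   Context: All graphs are finite, simple and undirected. $\mathrm{D}_{2n}$ is the dihedral group of order $2n$ (for $n=2$ it is $\mathbb{Z}_2^2$); $x^y=y^{-1}xy$. For a finite group $G$ and $S\subseteq G\setminus\{1\}$ with $S=S^{-1}$, $\mathrm{Cay}(G,S)$ is the graph with vertex set $G$ in which $x,y$ are adjacent iff $yx^{-1}\in S$; it is inner-automorphic if $S$ is a union of conjugacy classes of $G$. A graph $\Gamma$ is $2$-distance-transitive if $A=\mathrm{Aut}(\Gamma)$ is transitive on vertices and, for each vertex $u$ and each $i\le 2$, the stabilizer $A_u$ is transitive on the set $\Gamma_i(u)$ of vertices at distance $i$ from $u$ (with the condition vacuous if $\Gamma_i(u)$ is empty). $\mathsf{K}_{2n}$ is the complete graph on $2n$ vertices, $\mathsf{K}_{n,n}$ the complete bipartite graph with parts of size $n$, $\mathsf{K}_{n,n}-n\mathsf{K}_2$ is $\mathsf{K}_{n,n}$ minus a perfect matching, and $\mathsf{K}_{m[t]}$ is the complete multipartite graph with $m$ parts of size $t$. *)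

(* Defs.v *)
From HB Require Import structures.
From mathcomp Require Import all_boot all_fingroup all_solvable.

Set Implicit Arguments.
Unset Strict Implicit.
Unset Printing Implicit Defensive.

Import GroupScope.

(* A graph is given by its adjacency relation on a finite vertex type.  All the
   concrete graphs below are symmetric and irreflexive; see the lemmas. *)

Definition graph_iso (V W : finType) (e : rel V) (e' : rel W) : Prop :=
  exists2 f : V -> W, bijective f & forall x y, e' (f x) (f y) = e x y.

Definition graph_connected (V : finType) (e : rel V) : Prop :=
  forall x y, connect e x y.

Section Automorphisms.
Variables (V : finType) (e : rel V).

Definition graph_Aut : {set {perm V}} :=
  [set s : {perm V} | [forall x, forall y, e (s x) (s y) == e x y]].

Lemma graph_Aut_group_set : group_set graph_Aut.
Proof.
apply/group_setP; split=> [|s t].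
  by rewrite inE; apply/forallP=> x; apply/forallP=> y; rewrite !perm1.
rewrite !inE => /forallP hs /forallP ht; apply/forallP=> x; apply/forallP=> y.
by rewrite !permM (eqP (forallP (ht _) _)) (forallP (hs x) y).
Qed.

Canonical graph_Aut_group := Group graph_Aut_group_set.

Definition has_walk (i : nat) (u v : V) : bool :=
  [exists p : i.-tuple V, path e u p && (last u p == v)].

Definition at_distance (i : nat) (u v : V) : bool :=
  has_walk i u v && [forall j : 'I_i, ~~ has_walk j u v].

Definition sphere (i : nat) (u : V) : {set V} := [set v | at_distance i u v].

(* [transitive A, on X | to] is false for empty X, hence the disjunction. *)
Definition two_distance_transitive : Prop :=
  [transitive graph_Aut, on [set: V] | 'P] /\
  forall (u : V) (i : nat), i <= 2 ->
    sphere i u = set0 \/ [transitive 'C_graph_Aut[u | 'P], on sphere i u | 'P].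

End Automorphisms.

Section Cayley.
Variable gT : finGroupType.

Definition Cay (S : {set gT}) : rel gT := fun x y => y * x^-1 \in S.

Definition cayley_set (S : {set gT}) : Prop :=
  1 \notin S /\ (forall x, (x^-1 \in S) = (x \in S)).

Definition inner_automorphic (S : {set gT}) : Prop :=
  exists2 P : {set {set gT}}, P \subset classes [set: gT] & S = cover P.

Lemma Cay_irr (S : {set gT}) : cayley_set S -> irreflexive (Cay S).
Proof. by case=> S1 _ x; rewrite /Cay mulgV; apply: negbTE. Qed.

Lemma Cay_sym (S : {set gT}) : cayley_set S -> symmetric (Cay S).
Proof. by case=> _ SV x y; rewrite /Cay -SV invMg invgK. Qed.

(* The whole group is < a, b | a^n = b^2 = 1, a^b = a^-1 >, with a and b the
   images of the two generators of the presentation. *)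
Definition dihedral_presentation (n : nat) (a b : gT) : Prop :=
  [/\ [set: gT] \isog Grp (x : y : x ^+ n, y ^+ 2, x ^ y = x^-1),
      <<[set a; b]>> = [set: gT],
      a ^+ n = 1, b ^+ 2 = 1 & a ^ b = a^-1].

Variables a b : gT.

Definition all_refl (n : nat) : {set gT} :=
  [set a ^+ i * b | i : 'I_n.+1 & 1 <= i].

Definition even_refl (k : nat) : {set gT} :=
  [set a ^+ (2 * i) * b | i : 'I_k.+1 & 1 <= i].

Definition odd_refl (k : nat) : {set gT} :=
  [set a ^+ (2 * i + 1) * b | i : 'I_k.+1 & 1 <= i].

Definition odd_rot (k : nat) : {set gT} :=
  [set a ^+ (2 * i + 1) | i : 'I_k.+1 & 1 <= i].

Definition odd_rot_but_k (k : nat) : {set gT} :=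
  [set a ^+ (2 * j + 1) | j : 'I_k.+1 & (1 <= j) && (2 * j + 1 != k)].

End Cayley.

Definition complete_graph (N : nat) : rel 'I_N := fun x y => x != y.

(* Complete bipartite graph K_{n,n}; the parts are indexed by bool. *)
Definition Knn (n : nat) : rel (bool * 'I_n) := fun x y => x.1 != y.1.

(* K_{n,n} - n K_2: the perfect matching {(false, i), (true, i)} is removed. *)
Definition Knn_minus_nK2 (n : nat) : rel (bool * 'I_n) :=
  fun x y => (x.1 != y.1) && (x.2 != y.2).

(* Complete multipartite graph with m parts of size t. *)
Definition Kmulti (m t : nat) : rel ('I_m * 'I_t) := fun x y => x.1 != y.1.

Lemma complete_graph_simple N :
  symmetric (@complete_graph N) /\ irreflexive (@complete_graph N).
Proof. by split=> [x y|x]; rewrite /complete_graph ?eqxx // eq_sym. Qed.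

Lemma Knn_simple n : symmetric (@Knn n) /\ irreflexive (@Knn n).
Proof. by split=> [x y|x]; rewrite /Knn ?eqxx // eq_sym. Qed.

Lemma Knn_minus_nK2_simple n :
  symmetric (@Knn_minus_nK2 n) /\ irreflexive (@Knn_minus_nK2 n).
Proof.
split=> [x y|x]; rewrite /Knn_minus_nK2 ?eqxx //.
by rewrite eq_sym [x.2 == _]eq_sym.
Qed.

Lemma Kmulti_simple m t :
  symmetric (@Kmulti m t) /\ irreflexive (@Kmulti m t).
Proof. by split=> [x y|x]; rewrite /Kmulti ?eqxx // eq_sym. Qed.

(* Main.v *)
Require Import Defs.
From HB Require Import structures.
From mathcomp Require Import all_boot all_fingroup all_solvable.

Set Implicit Arguments.
Unset Strict Implicit.
Unset Printing Implicit Defensive.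

Import GroupScope.

(** Let [N] be the complement of [S], let [C = <[a]>] and [E = <[a ^+ 2]>].
    The common non-neighbours of [1] and [g] form the set [N :&: N :* g], so
    2-distance-transitivity makes [#|N :&: N :* g|] constant for [g] in [S],
    and constant for [g] at distance 2 from [1].  Beyond these
    two facts the classification uses only connectedness and normality of [S].

    As the graph is connected, [S] contains a reflection [x], hence the
    conjugacy class of [x], which is the coset [E :* x].

    If [S] contains every reflection, then [N] lies in [C], so [1] and [x]
    have no common non-neighbour.  Hence no neighbour of [1] has one, and this
    says exactly that [N] is a subgroup ([group_set_nonneighbours]).  A Cayley
    graph on the complement of a subgroup is complete multipartite, its parts
    being the cosets; it is K_{2n}, K_{n,n} or K_{m[t]} according to the order
    and the index of the subgroup.

    Otherwise [n = 2k], and [S] misses the other class of reflections, which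
    with [E] forms an index-2 subgroup [L].  Counting common non-neighbours of
    [1] and its neighbours shows that [S] misses [L], so the graph is
    bipartite; counting those of [1] and vertices at distance 2 shows that the
    complement of [L] contains at most one non-neighbour of [1]
    ([neighbours_bipartite]).  This gives K_{n,n} when there is none and
    K_{n,n} - n K_2 when there is one, [z].  Then [z] is an involution in
    [C :\: L], which forces [k] to be odd, and connectedness excludes [k = 1].

    Conversely the model graphs are 2-distance-transitive because
    transpositions of vertices, of parts or of indices provide the required
    automorphisms, and the sets of the statement are complements of subgroups,
    up to the involution [a ^+ k] in case (ii). *)

(** * Two-distance-transitivity through explicit automorphisms *)

Lemma graph_AutP (V : finType) (e : rel V) (s : {perm V}) :
  reflect (forall x y, e (s x) (s y) = e x y) (s \in graph_Aut e).
Proof.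
rewrite inE; apply: (iffP forallP) => [h x y | h x].
  exact: eqP (forallP (h x) y).
by apply/forallP=> y; rewrite h.
Qed.

Definition dist2 (V : finType) (e : rel V) : rel V :=
  fun u v => [&& u != v, ~~ e u v & [exists z, e u z && e z v]].

Section Spheres.
Variables (V : finType) (e : rel V).

Lemma has_walk0 u v : has_walk e 0 u v = (u == v).
Proof.
apply/existsP/eqP=> [[p] | ->]; first by rewrite (tuple0 p) /= => /eqP.
by exists [tuple]; rewrite /= eqxx.
Qed.

Lemma has_walk1 u v : has_walk e 1 u v = e u v.
Proof.
apply/existsP/idP=> [[p] | euv].
  by case: p => -[|x [|y p]] //= _; rewrite andbT => /andP[eux /eqP <-].
by exists [tuple v]; rewrite /= euv eqxx.
Qed.

Lemma has_walk2 u v : has_walk e 2 u v = [exists z, e u z && e z v].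
Proof.
apply/existsP/existsP=> [[p] | [z /andP[euz ezv]]].
  case: p => -[|x [|y [|z p]]] //= _; rewrite andbT.
  by case/andP=> /andP[eux exy] /eqP <-; exists x; rewrite eux.
by exists [tuple z; v]; rewrite /= euz ezv eqxx.
Qed.

Lemma sphere0 u : sphere e 0 u = [set u].
Proof.
apply/setP=> v; rewrite !inE /at_distance has_walk0 [v == u]eq_sym.
by rewrite andbC; case: forallP => //; case=> -[].
Qed.

Lemma in_sphere1 u v : irreflexive e -> (v \in sphere e 1 u) = e u v.
Proof.
move=> irr; rewrite inE /at_distance has_walk1; case euv: (e u v) => //=.
apply/forallP=> -[[|j] //= _]; rewrite has_walk0.
by apply: contraTneq euv => ->; rewrite irr.
Qed.

Lemma in_sphere2 u v : (v \in sphere e 2 u) = dist2 e u v.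
Proof.
rewrite inE /at_distance has_walk2 /dist2 andbC andbA; congr (_ && _).
apply/forallP/andP=> [h | [nuv neuv] [[|[|j]] //= _]].
- by have := h ord0; have := h ord_max; rewrite /= has_walk0 has_walk1.
- by rewrite has_walk0.
by rewrite has_walk1.
Qed.

Lemma Aut_dist2 s u v :
  s \in graph_Aut e -> dist2 e (s u) (s v) = dist2 e u v.
Proof.
move/graph_AutP=> hs; rewrite /dist2 hs (inj_eq perm_inj).
congr [&& _, _ & _]; apply/existsP/existsP=> -[z /andP[euz ezv]].
  by exists (s^-1 z); rewrite -(hs u) -(hs _ v) permKV euz.
by exists (s z); rewrite !hs euz.
Qed.

Lemma transitive_perm (A : {group {perm V}}) (X : {set V}) x0 :
    x0 \in X -> (forall s x, s \in A -> x \in X -> s x \in X) ->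
    (forall x, x \in X -> exists2 s, s \in A & s x0 = x) ->
  [transitive A, on X | 'P].
Proof.
move=> Xx0 AX trX; apply/imsetP; exists x0 => //; apply/setP=> x.
apply/idP/orbitP=> [/trX[s As <-] | [s As <-]]; first by exists s.
exact: AX.
Qed.

Lemma in_AutC (s : {perm V}) u :
  (s \in 'C_(graph_Aut e)[u | 'P]) = (s \in graph_Aut e) && (s u == u).
Proof. by rewrite inE; congr (_ && _); apply/astab1P/eqP. Qed.

Lemma two_distance_transitiveP (x0 : V) : irreflexive e ->
  two_distance_transitive e <->
  [/\ forall u v, exists2 s, s \in graph_Aut e & s u = v,
      forall u v w, e u v -> e u w ->
        exists2 s, s \in graph_Aut e & s u = u /\ s v = w &
      forall u v w, dist2 e u v -> dist2 e u w ->
        exists2 s, s \in graph_Aut e & s u = u /\ s v = w].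
Proof.
move=> irr; split=> [[trV trS] | [trV tr1 tr2]].
  have fixP i u v w : i <= 2 -> v \in sphere e i u -> w \in sphere e i u ->
      exists2 s, s \in graph_Aut e & s u = u /\ s v = w.
    move=> le_i uv uw; have [X0 | tr] := trS u i le_i; first by rewrite X0 inE in uv.
    have [s] := atransP2 tr uv uw.
    by rewrite in_AutC => /andP[As /eqP su] ->; exists s.
  split=> [u v | u v w uv uw | u v w uv uw].
  - by have [s As ->] := atransP2 trV (in_setT u) (in_setT v); exists s.
  - by apply: (fixP 1%N); rewrite ?in_sphere1.
  by apply: (fixP 2%N); rewrite ?in_sphere2.
split=> [|u i le_i].
  by apply: (transitive_perm (in_setT x0)) => // x _; exact: trV.
have [-> | [v uv]] := set_0Vmem (sphere e i u); [by left | right].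
apply: (transitive_perm uv) => /= [s x | w uw].
  rewrite in_AutC => /andP[As /eqP su].
  case: i le_i {uv} => [|[|[|]]] // _; rewrite ?sphere0 ?in_sphere1 ?in_sphere2 //.
  - by rewrite !inE => /eqP ->; rewrite su.
  - by rewrite -{2}su (graph_AutP _ _ As).
  by rewrite -{2}su Aut_dist2.
suffices [s As [su sv]] : exists2 s, s \in graph_Aut e & s u = u /\ s v = w.
  by exists s; rewrite // in_AutC As su eqxx.
case: i le_i uv uw => [|[|[|]]] // _; rewrite ?sphere0 ?in_sphere1 ?in_sphere2 //.
- by move=> /set1P-> /set1P->; exists 1; rewrite ?group1 ?perm1.
- exact: tr1.
exact: tr2.
Qed.

End Spheres.

(** * Graph isomorphisms *)

Lemma graph_iso_sym (V W : finType) (e : rel V) (e' : rel W) :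
  graph_iso e e' -> graph_iso e' e.
Proof.
by case=> f [g fK gK] ef; exists g => [|x y]; [exists f | rewrite -ef !gK].
Qed.

Lemma graph_iso_Aut (V W : finType) (e : rel V) (e' : rel W) f g s :
    cancel f g -> cancel g f -> (forall x y, e' (f x) (f y) = e x y) ->
    s \in graph_Aut e' ->
  exists2 r, r \in graph_Aut e & forall x, r x = g (s (f x)).
Proof.
move=> fK gK ef /graph_AutP hs.
have inj : injective (fun x => g (s (f x))).
  by move=> x y /(can_inj gK)/perm_inj/(can_inj fK).
exists (perm inj) => [|x]; last by rewrite permE.
by apply/graph_AutP=> x y; rewrite !permE -ef !gK hs.
Qed.

Lemma iso_two_distance_transitive (V W : finType) (e : rel V) (e' : rel W) :
    irreflexive e' -> graph_iso e e' ->
  two_distance_transitive e' -> two_distance_transitive e.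
Proof.
move=> irr' [f [g fK gK] ef] tr'.
have irr : irreflexive e by move=> x; rewrite -ef irr'.
have [y0 _ _] : exists2 y : W, y \in [set: W] & true.
  by case: tr' => /imsetP[y _ _] _; exists y.
have [trV tr1 tr2] := (two_distance_transitiveP y0 irr').1 tr'.
have d2 x y : dist2 e' (f x) (f y) = dist2 e x y.
  rewrite /dist2 ef (can_eq fK); congr [&& _, _ & _].
  apply/existsP/existsP=> -[z zP]; first by exists (g z); rewrite -!ef gK.
  by exists (f z); rewrite !ef.
apply/(two_distance_transitiveP (g y0) irr); split=> [u v|u v w|u v w].
- have [s /(graph_iso_Aut fK gK ef)[r Ar rE] sE] := trV (f u) (f v).
  by exists r; rewrite // rE sE fK.
- rewrite -!ef => uv uw.
  have [s /(graph_iso_Aut fK gK ef)[r Ar rE] [su sv]] := tr1 _ _ _ uv uw.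
  by exists r; rewrite // !rE su sv !fK.
rewrite -!d2 => uv uw.
have [s /(graph_iso_Aut fK gK ef)[r Ar rE] [su sv]] := tr2 _ _ _ uv uw.
by exists r; rewrite // !rE su sv !fK.
Qed.

(** * The model graphs *)

Definition multipartite (I J : finType) : rel (I * J) := fun x y => x.1 != y.1.

Section Multipartite.
Variables I J : finType.
Implicit Types u v w : I * J.
Let e : rel (I * J) := @multipartite I J.

Definition part_swap (i i' : I) (x : I * J) := (tperm i i' x.1, x.2).

Lemma part_swap_inj i i' : injective (part_swap i i').
Proof. by move=> [x y] [z t] [/perm_inj -> ->]. Qed.

Lemma part_swap_Aut i i' : perm (@part_swap_inj i i') \in graph_Aut e.
Proof.
by apply/graph_AutP=> x y; rewrite !permE /e /multipartite (inj_eq perm_inj).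
Qed.

Lemma tperm_Aut v w : v.1 = w.1 -> tperm v w \in graph_Aut e.
Proof.
move=> vw; apply/graph_AutP=> x y; rewrite /e /multipartite.
by have tE z : (tperm v w z).1 = z.1; [case: tpermP => // -> | rewrite !tE].
Qed.

(** Exchange the parts of [v] and [w], then correct inside the part of [w]; both
    steps fix every vertex outside these two parts. *)
Lemma multipartite_move v w :
  exists2 s, s \in graph_Aut e &
    s v = w /\ forall u, u.1 != v.1 -> u.1 != w.1 -> s u = u.
Proof.
pose p := perm (@part_swap_inj v.1 w.1).
have pv : p v = (w.1, v.2) by rewrite permE /part_swap tpermL.
exists (p * tperm (w.1, v.2) w).
  by rewrite groupM ?part_swap_Aut ?tperm_Aut.
split=> [|u nuv nuw]; first by rewrite permM pv tpermL.
have pu : p u = u.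
  by rewrite permE /part_swap tpermD 1?eq_sym // -surjective_pairing.
by rewrite permM pu tpermD //; apply: contraNneq nuw => <-.
Qed.

Lemma multipartite_two_distance_transitive (x0 : I * J) :
  two_distance_transitive e.
Proof.
apply/(two_distance_transitiveP x0); first by move=> x; rewrite /e /multipartite eqxx.
split=> [u v | u v w uv uw | u v w].
- by have [s As [suv _]] := multipartite_move u v; exists s.
- have [s As [svw sfix]] := multipartite_move v w.
  by exists s => //; split; first exact: sfix.
case/and3P=> nuv /negbNE/eqP uv _ /and3P[nuw /negbNE/eqP uw _].
exists (tperm v w); first by rewrite tperm_Aut // -uv.
by rewrite tpermL tpermD 1?eq_sym.
Qed.

(** The second coordinate of a vertex is its rank in an enumeration of its
    fibre. *)
Lemma fibres_multipartite (V : finType) (d : rel V) (p : V -> I) :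
    (forall x y, d x y = (p x != p y)) ->
    (forall i, #|[set x | p x == i]| = #|J|) ->
  graph_iso d e.
Proof.
move=> dE cardp; pose F i := [set x | p x == i].
have Fp x : x \in F (p x) by rewrite inE.
pose f x : I * J :=
  (p x, enum_val (cast_ord (cardp (p x)) (enum_rank_in (Fp x) x))).
exists f; last by move=> x y; rewrite /e /multipartite /= dE.
apply: inj_card_bij => [x y [pxy] /enum_val_inj/(congr1 val)/= rxy|].
  have Fyx : y \in F (p x) by rewrite pxy.
  rewrite -(enum_rankK_in (Fp x) (Fp x)) -(enum_rankK_in (Fp y) (Fp y)).
  rewrite !(enum_val_nth x) rxy.
  by rewrite (_ : enum (F (p x)) = enum (F (p y))) // pxy.
rewrite card_prod -[X in _ <= X]sum1_card (partition_big p predT) //=.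
rewrite (eq_bigr (fun=> #|J|)) ?sum_nat_const // => i _.
by rewrite -(cardp i) cardsE -sum1_card; apply: eq_bigl.
Qed.

End Multipartite.

Lemma Knn_two_distance_transitive n : 0 < n ->
  two_distance_transitive (@Knn n).
Proof.
case: n => // n _.
exact: (multipartite_two_distance_transitive (false, ord0 : 'I_n.+1)).
Qed.

Lemma Kmulti_two_distance_transitive m t : 0 < m -> 0 < t ->
  two_distance_transitive (@Kmulti m t).
Proof.
case: m => // m _; case: t => // t _.
exact: (multipartite_two_distance_transitive (ord0 : 'I_m.+1, ord0 : 'I_t.+1)).
Qed.

Lemma complete_two_distance_transitive N : 0 < N ->
  two_distance_transitive (@complete_graph N).
Proof.
move=> N_gt0; apply: (iso_two_distance_transitive (Kmulti_simple N 1).2).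
  apply: (@fibres_multipartite 'I_N 'I_1 _ _ id) => // i.
  by rewrite card_ord (_ : [set x | _] = [set i]) ?cards1 //; apply/setP=> x; rewrite !inE.
exact: Kmulti_two_distance_transitive.
Qed.

Definition matching_swap n (c : bool) (j j' : 'I_n) (x : bool * 'I_n) :=
  (c (+) x.1, tperm j j' x.2).

Lemma matching_swap_inj n c (j j' : 'I_n) : injective (matching_swap c j j').
Proof. by move=> [x y] [z t] [/addbI -> /perm_inj ->]. Qed.

Lemma matching_swap_Aut n c (j j' : 'I_n) :
  perm (@matching_swap_inj n c j j') \in graph_Aut (@Knn_minus_nK2 n).
Proof.
apply/graph_AutP=> x y; rewrite !permE /Knn_minus_nK2 /=.
by rewrite (inj_eq perm_inj) (inj_eq (@addbI c)).
Qed.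

(** The vertices at distance 2 from a vertex form the rest of its side: the
    matched vertex on the other side has no common neighbour with it.  Hence
    permuting the indices is enough. *)
Lemma Knn_minus_nK2_two_distance_transitive n : 0 < n ->
  two_distance_transitive (@Knn_minus_nK2 n).
Proof.
move=> n_gt0; have x0 : bool * 'I_n by case: n n_gt0 => // n _; exact: (false, ord0).
have move1 (u v w : bool * 'I_n) : v.1 = w.1 -> u.2 != v.2 -> u.2 != w.2 ->
    exists2 s, s \in graph_Aut (@Knn_minus_nK2 n) & s u = u /\ s v = w.
  case: u v w => [c j] [c1 j1] [c2 j2] /= -> nj1 nj2.
  exists (perm (@matching_swap_inj n false j1 j2)); first exact: matching_swap_Aut.
  by rewrite !permE /matching_swap /= tpermL tpermD 1?eq_sym.
apply/(two_distance_transitiveP x0); first exact: (Knn_minus_nK2_simple n).2.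
split=> [[c j] [c' j'] | u v w /andP[uv1 uv2] /andP[uw1 uw2] | u v w].
- exists (perm (@matching_swap_inj n (c (+) c') j j')).
    exact: matching_swap_Aut.
  by rewrite permE /matching_swap /= tpermL addbAC addbb.
- by apply: move1 => //; case: u.1 v.1 w.1 uv1 uw1 => [] [] [].
have dist2E (x y : bool * 'I_n) : dist2 (@Knn_minus_nK2 n) x y ->
    x.1 = y.1 /\ x.2 != y.2.
  case: x y => [c j] [c' j'] /and3P[nxy _ /existsP[[c2 j2]]] /=.
  case/andP=> /andP[/= cc2 _] /andP[/= c2c' _].
  have cc' : c = c' by case: c c' c2 cc2 c2c' {nxy} => [] [] [].
  by split=> //; apply: contraNneq nxy => ->; rewrite cc'.
case/dist2E=> uv1 uv2 /dist2E[uw1 uw2]; apply: move1 => //.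
by rewrite -uv1.
Qed.

(** * Cayley graphs on the complement of a subgroup *)

Section CayleyModels.
Variable gT : finGroupType.
Implicit Types (S : {set gT}) (H : {group gT}).

Lemma Cay_complete N : #|[set: gT]| = N ->
  graph_iso (Cay ([set: gT] :\ 1)) (@complete_graph N).
Proof.
rewrite cardsT => oG; exists (fun x => cast_ord oG (enum_rank x)) => [|x y].
  by apply: inj_card_bij => [x y /cast_ord_inj/enum_rank_inj|]; rewrite ?card_ord ?oG.
rewrite /complete_graph (inj_eq (@cast_ord_inj _ _ oG)) (inj_eq enum_rank_inj).
by rewrite /Cay !inE andbT -eq_mulgV1 eq_sym.
Qed.

Lemma Cay_setC_Knn H n : #|[set: gT]| = (2 * n)%N -> #|H| = n ->
    (forall x y, (x * y \in H) = ((x \in H) == (y \in H))) ->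
  graph_iso (Cay (~: H)) (@Knn n).
Proof.
move=> oG oH HM; apply: (@fibres_multipartite bool 'I_n _ _ (mem H)) => [x y|i].
  by rewrite /Cay inE HM groupV /= eq_sym.
rewrite card_ord; case: i.
  by rewrite -[RHS]oH; apply: eq_card => x; rewrite inE eqb_id.
rewrite (_ : [set x | _] = ~: H); last by apply/setP=> x; rewrite !inE eqbF_neg.
by rewrite cardsCs setCK -cardsT oG oH mul2n -addnn addnK.
Qed.

Lemma Cay_setC_Kmulti H m t : (m * t)%N = #|[set: gT]| -> #|H| = t ->
  graph_iso (Cay ([set: gT] :\: H)) (@Kmulti m t).
Proof.
move=> oG oH; have t_gt0 : 0 < t by rewrite -oH cardG_gt0.
have om : #|rcosets H [set: gT]| = m.
  by apply/eqP; rewrite -(eqn_pmul2r t_gt0) oG -oH mulnC Lagrange ?subsetT.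
have Hcoset x : H :* x \in rcosets H [set: gT].
  by apply/rcosetsP; exists x; rewrite ?inE.
pose p x := cast_ord om (enum_rank_in (Hcoset 1) (H :* x)).
have pE x y : (p x == p y) = (x \in H :* y).
  rewrite (inj_eq (@cast_ord_inj _ _ om)).
  rewrite (can_in_eq (enum_rankK_in (Hcoset 1))) //.
  by apply/eqP/idP=> [<- | /rcoset_eqP]; rewrite ?rcoset_refl.
apply: (@fibres_multipartite 'I_m 'I_t _ _ p) => [x y | i].
  by rewrite /Cay inE !inE andbT eq_sym pE mem_rcoset.
have /rcosetsP[x _ xE] := enum_valP (cast_ord (esym om) i).
rewrite card_ord -oH -(card_rcoset H x); apply: eq_card => y.
have px : p x = i.
  by rewrite /p -xE enum_valK_in; apply: val_inj.
by rewrite inE -px pE.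
Qed.

(** Left multiplication by an involution [z] outside the index-2 subgroup [H]
    exchanges the two parts, and matches each vertex with its only
    non-neighbour on the other side. *)
Lemma Cay_setC1_Knn_minus_nK2 H n z : #|[set: gT]| = (2 * n)%N -> #|H| = n ->
    (forall x y, (x * y \in H) = ((x \in H) == (y \in H))) ->
    z \notin H -> z * z = 1 ->
  graph_iso (Cay (~: H :\ z)) (@Knn_minus_nK2 n).
Proof.
move=> oG oH HM Hz zz.
pose q x := if x \in H then x else z * x.
have Hq x : q x \in H.
  by rewrite /q; case: ifP => // Hx; rewrite HM (negPf Hz) Hx.
pose r x := cast_ord oH (enum_rank_in (group1 H) (q x)).
have rE x y : (r x == r y) = (q x == q y).
  rewrite (inj_eq (@cast_ord_inj _ _ oH)).
  by rewrite (can_in_eq (enum_rankK_in (group1 H))).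
exists (fun x => (x \in H, r x)) => [|x y].
  apply: inj_card_bij => [x y /eqP | ].
    rewrite xpair_eqE rE /q => /andP[/eqP ->].
    by case: ifP => _ /eqP // /mulgI.
  by rewrite card_prod card_bool card_ord -cardsT oG.
have qE : (y * x^-1 == z) = (z * x == y).
  by apply/eqP/eqP=> [<- | <-]; rewrite ?mulgKV ?mulgK.
rewrite /Knn_minus_nK2 /Cay /= rE !inE HM groupV qE andbC /q.
case Hx: (x \in H); case Hy: (y \in H); rewrite /= ?andbT ?andbF //.
by rewrite -(inj_eq (mulgI z)) mulgA zz mul1g.
Qed.

End CayleyModels.

(** * Counting common non-neighbours *)

Section Cayley2DT.
Variables (gT : finGroupType) (S : {set gT}).
Hypothesis cayS : cayley_set S.
Hypothesis trS : two_distance_transitive (Cay S).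
Implicit Types (C L H : {group gT}).
Let N := ~: S.

Let one_notin_S : 1 \notin S.
Proof. by case: cayS. Qed.

Let inv_S x : (x^-1 \in S) = (x \in S).
Proof. by case: cayS => _ ->. Qed.

(** [N :&: N :* g] is the set of common non-neighbours of [1] and [g], so an
    automorphism fixing [1] carries it to the corresponding set for the image
    of [g]. *)
Lemma card_common_nonneighbours s g :
  s \in graph_Aut (Cay S) -> s 1 = 1 ->
  #|N :&: N :* s g| = #|N :&: N :* g|.
Proof.
move=> /graph_AutP hs s1; pose F g := [set z | ~~ Cay S 1 z & ~~ Cay S g z].
have FE h : N :&: N :* h = F h.
  by apply/setP=> z; rewrite !inE mem_rcoset !inE /Cay invg1 mulg1.
rewrite !FE -(card_imset (mem (F g)) (@perm_inj _ s)); apply: eq_card => z.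
rewrite -[z](permKV s) (mem_imset _ _ perm_inj) !inE hs.
by rewrite -[in Cay S 1 _]s1 hs.
Qed.

Lemma card_nonneighbours_S g h : g \in S -> h \in S ->
  #|N :&: N :* g| = #|N :&: N :* h|.
Proof.
have [_ tr1 _] := (two_distance_transitiveP 1 (Cay_irr cayS)).1 trS.
have e1 x : Cay S 1 x = (x \in S) by rewrite /Cay invg1 mulg1.
rewrite -!e1 => eg eh; have [s As [s1 <-]] := tr1 _ _ _ eg eh.
by rewrite card_common_nonneighbours.
Qed.

Lemma card_nonneighbours_dist2 g h : dist2 (Cay S) 1 g -> dist2 (Cay S) 1 h ->
  #|N :&: N :* g| = #|N :&: N :* h|.
Proof.
have [_ _ tr2] := (two_distance_transitiveP 1 (Cay_irr cayS)).1 trS.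
move=> dg dh; have [s As [s1 <-]] := tr2 _ _ _ dg dh.
by rewrite card_common_nonneighbours.
Qed.

(** If one neighbour [b] has no common non-neighbour with [1], then by
    arc-transitivity no neighbour has one.  For [x], [y] in [N] the product
    [x * y] cannot be a neighbour, because [y] would be a common
    non-neighbour of [1] and [x * y]. *)
Lemma group_set_nonneighbours b :
  b \in S -> N :&: N :* b = set0 -> group_set N.
Proof.
move=> Sb Nb0; apply/group_setP; split=> [|x y Nx Ny]; first by rewrite inE.
rewrite inE; apply/negP=> Sxy; have/eqP := card_nonneighbours_S Sxy Sb.
rewrite Nb0 cards0 cards_eq0 => /eqP/setP/(_ y); rewrite !inE mem_rcoset.
move: Nx Ny; rewrite !inE invMg mulgA mulgV mul1g inv_S => -> ->.
by [].
Qed.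

Section TwoSubgroups.
(* The parity hypotheses say that [C] and [L] have index at most 2.  The
   vertices are thus split into four cosets of [C :&: L], of which [S] contains
   the one of [b] and misses [L :\: C]. *)
Variables C L : {group gT}.
Hypothesis CM : forall x y, (x * y \in C) = ((x \in C) == (y \in C)).
Hypothesis LM : forall x y, (x * y \in L) = ((x \in L) == (y \in L)).
Variables b r0 : gT.
Hypotheses (Cb : b \notin C) (Lb : b \notin L).
Hypotheses (Sr0 : r0 \in S) (Cr0 : r0 \in C) (Lr0 : r0 \notin L).
Hypothesis subS : forall x, x \notin C -> x \notin L -> x \in S.
Hypothesis Ssub : forall x, x \in S -> x \notin C -> x \notin L.

Let N1 := (N :&: C) :\: L.

Let N1P x : (x \in N1) = [&& x \notin S, x \in C & x \notin L].
Proof. by rewrite !inE andbC -andbA. Qed.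

Let Sb : b \in S. Proof. exact: subS. Qed.

Let NP x : x \notin L -> (x \notin S) = (x \in N1).
Proof.
move=> Lx; rewrite N1P Lx andbT; case: (boolP (x \in C)) => Cx; rewrite ?andbT //.
by rewrite subS // andbF.
Qed.

Let LCN x : x \in L -> x \notin C -> x \notin S.
Proof. by move=> Lx Cx; apply/negP=> /Ssub/(_ Cx); rewrite Lx. Qed.

Let nonneighbours_b : #|N :&: N :* b| = (#|N1| + #|N1|)%N.
Proof.
have -> : N :&: N :* b = N1 :|: N1 :* b.
  apply/setP=> x; rewrite in_setI in_setU !mem_rcoset !N1P !in_setC.
  have Cxb : (x * b^-1 \in C) = (x \notin C) by rewrite CM groupV (negPf Cb) eqbF_neg.
  have Lxb : (x * b^-1 \in L) = (x \notin L) by rewrite LM groupV (negPf Lb) eqbF_neg.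
  rewrite Cxb Lxb.
  case: (boolP (x \in C)) => Cx; case: (boolP (x \in L)) => Lx;
    rewrite /= ?andbT ?andbF ?orbF //=.
  - by rewrite [x * _ \in S]subS ?andbF // ?Cxb ?Lxb ?Cx ?Lx.
  - by rewrite [x * _ \notin S]LCN ?andbT // ?Cxb ?Lxb ?Cx ?Lx.
  - by rewrite LCN.
  by rewrite subS.
rewrite -{2}(card_rcoset N1 b).
apply/eqP; rewrite (leq_card_setU N1 (N1 :* b)).
apply/pred0P=> x /=; apply/negP=> /andP[].
rewrite N1P mem_rcoset N1P CM groupV (negPf Cb) => /and3P[_ -> _].
by rewrite /= andbF.
Qed.

(** For [r] in [S :\: L], the common non-neighbours of [1] and [r] lie in
    [N1 :|: N1 :* r].  This set has at most as many elements as there are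
    common non-neighbours of [1] and [b], and these are as numerous as those of
    [1] and [r]; so the inclusion is an equality. *)
Let N1_mul r x : r \in S -> r \notin L -> x \in N1 -> x * r \notin S.
Proof.
move=> Sr Lr N1x.
have sub : N :&: N :* r \subset N1 :|: N1 :* r.
  apply/subsetP=> y.
  rewrite in_setI in_setU !mem_rcoset !in_setC => /andP[nSy nSyr].
  case: (boolP (y \in L)) => Ly; last by rewrite -NP ?nSy.
  by rewrite -[y * _ \in _]NP ?nSyr ?orbT // LM groupV Ly (negPf Lr).
have/eqP eqN : N :&: N :* r == N1 :|: N1 :* r.
  rewrite eqEcard sub (card_nonneighbours_S Sr Sb) nonneighbours_b.
  by rewrite -{2}(card_rcoset N1 r) leq_card_setU.
have : x * r \in N :&: N :* r by rewrite eqN in_setU mem_rcoset mulgK N1x orbT.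
by rewrite !inE => /andP[].
Qed.

(** A neighbour [r] in [C :&: L] would have all of [N1] and of [L :\: C] as
    common non-neighbours with [1].  Since [L :\: C] has the size of
    [C :\: L], comparing with the count at [b] makes [N1] all of [C :\: L],
    but [r0] is not in it. *)
Let no_neighbour_CL r : r \in S -> r \in C -> r \in L -> False.
Proof.
move=> Sr Cr Lr; pose W := L :\: C.
have N1r x : x \in N1 -> x * r^-1 \in N1.
  move=> N1x; have := N1x; rewrite !N1P => /and3P[nSx Cx Lx].
  rewrite CM LM !groupV Cr Lr Cx (negPf Lx) /= andbT.
  apply/negP=> Sxr.
  have : x^-1 \in N1 by rewrite N1P inv_S !groupV nSx Cx.
  move/(N1_mul Sxr); rewrite LM groupV Lr (negPf Lx) => /(_ isT).
  by rewrite mulKg inv_S Sr.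
have sub : N1 :|: W \subset N :&: N :* r.
  apply/subsetP=> x.
  rewrite in_setU [x \in W]in_setD in_setI in_setC => /orP[N1x | /andP[Cx Lx]].
    move: N1x (N1r _ N1x).
    by rewrite mem_rcoset in_setC !N1P => /and3P[-> _ _] /and3P[-> _ _].
  by rewrite mem_rcoset in_setC !LCN ?CM ?LM ?groupV ?Cr ?Lr ?Lx // (negPf Cx).
have leW : #|W| <= #|N1|.
  rewrite -(leq_add2l #|N1|) -nonneighbours_b -(card_nonneighbours_S Sr Sb).
  apply: leq_trans (subset_leq_card sub); rewrite eq_leq //.
  apply/esym/eqP; rewrite (leq_card_setU N1 W); apply/pred0P=> x /=.
  by apply/negP=> /andP[]; rewrite N1P inE => /and3P[_ -> _].
have eN1 : N1 = C :\: L.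
  apply/eqP; rewrite eqEcard; apply/andP; split.
    by apply/subsetP=> x; rewrite N1P inE => /and3P[_ -> ->].
  apply: leq_trans leW; rewrite -(card_rcoset (C :\: L) b).
  apply: subset_leq_card; apply/subsetP=> x; rewrite mem_rcoset !inE CM LM !groupV.
  by rewrite (negPf Cb) (negPf Lb); case: (x \in C); case: (x \in L).
have : r0 \in N1 by rewrite eN1 inE Lr0.
by rewrite N1P Sr0.
Qed.

Let dist2_L g : g \in L -> g != 1 -> dist2 (Cay S) 1 g.
Proof.
move=> Lg g1; have e1 x : Cay S 1 x = (x \in S) by rewrite /Cay invg1 mulg1.
rewrite /dist2 eq_sym g1 e1 /=; apply/andP; split.
  apply/negP=> Sg.
  by case: (boolP (g \in C)) => [/(no_neighbour_CL Sg) // | /(Ssub Sg)/negP].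
case: (boolP (g \in C)) => Cg; apply/existsP; [exists b | exists r0]; rewrite e1.
  by rewrite Sb /Cay subS // ?CM ?LM groupV ?Cg ?Lg ?(negPf Cb) ?(negPf Lb).
by rewrite Sr0 /Cay subS // ?CM ?LM groupV ?(negPf Cg) ?Lg ?Cr0 ?(negPf Lr0).
Qed.

(** Now [S] misses [L], so the graph is bipartite and all of [L :\ 1] is at
    distance 2 from [1].  An element of [L :\: C] has exactly [L] as its
    common non-neighbours with [1]; two elements [x <> y] of [N1] would add
    [y] to those of [x^-1 * y].  So [N1] has at most one element, which is an
    involution as [N1] is closed under inversion. *)
Lemma neighbours_bipartite :
  S = ~: L \/ exists z, [/\ z \in C, z \notin L, z * z = 1 & S = ~: L :\ z].
Proof.
have SL x : x \in S -> x \notin L.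
  move=> Sx; apply/negP=> Lx; case: (boolP (x \in C)) => [/(no_neighbour_CL Sx) // | Cx].
  by have := Ssub Sx Cx; rewrite Lx.
have SE x : (x \in S) = (x \notin L) && (x \notin N1).
  case: (boolP (x \in L)) => Lx; first by apply: contraTF Lx => /SL.
  by rewrite -NP // negbK.
have [N10 | [z N1z]] := set_0Vmem N1.
  by left; apply/setP=> x; rewrite SE N10 !inE andbT.
right; exists z; have := N1z; rewrite N1P => /and3P[nSz Cz Lz].
have leL g : g \in L -> g != 1 -> #|N :&: N :* g| <= #|L|.
  move=> Lg g1; pose h := r0 * b.
  have Lh : h \in L by rewrite LM (negPf Lr0) (negPf Lb).
  have Ch : h \notin C by rewrite CM Cr0 (negPf Cb).
  have h1 : h != 1 by apply: contraNneq Ch => ->; apply: group1.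
  rewrite (card_nonneighbours_dist2 (dist2_L Lg g1) (dist2_L Lh h1)).
  apply: subset_leq_card; apply/subsetP=> x; rewrite !inE mem_rcoset in_setC.
  case/andP=> nSx nSxh; apply: contraR nSxh => Lx; have := nSx; rewrite NP // N1P.
  case/and3P=> _ Cx _; apply: subS; rewrite ?CM ?LM groupV.
    by rewrite Cx (negPf Ch).
  by rewrite Lh (negPf Lx).
have N1_uniq x y : x \in N1 -> y \in N1 -> x = y.
  move=> N1x N1y; apply/eqP/negPn/negP=> nxy.
  have := N1x; have := N1y; rewrite !N1P => /and3P[nSy _ Ly] /and3P[nSx _ Lx].
  have Lg : x^-1 * y \in L by rewrite LM groupV (negPf Lx) (negPf Ly).
  have := leL _ Lg; rewrite -eq_mulVg1 => /(_ nxy); rewrite leqNgt => /negP[].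
  have <- : #|y |: L| = #|L|.+1 by rewrite cardsU1 Ly.
  apply: subset_leq_card; apply/subsetP=> t; rewrite !inE mem_rcoset in_setC.
  case/orP=> [/eqP -> | Lt]; first by rewrite invMg invgK mulKVg nSx nSy.
  by apply/andP; split; apply/negP=> /SL; rewrite ?LM ?groupV ?Lg Lt.
have zz : z^-1 = z by apply: N1_uniq => //; rewrite N1P inv_S !groupV nSz Cz.
split=> //; first by rewrite -{1}zz mulVg.
apply/setP=> x; rewrite SE in_setD1 in_setC andbC; congr (~~ _ && _).
by apply/idP/eqP=> [N1x | -> //]; apply: N1_uniq.
Qed.

End TwoSubgroups.
End Cayley2DT.

(** * Subgroups of index two *)

Section IndexTwo.
Variable gT : finGroupType.
Implicit Types C L H : {group gT}.

Lemma index2_mem H : #|[set: gT]| = (2 * #|H|)%N ->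
  forall x y, (x * y \in H) = ((x \in H) == (y \in H)).
Proof.
move=> oG x y; case: (boolP (x \in H)) => Hx; first by rewrite groupMl.
case: (boolP (y \in H)) => Hy; first by rewrite groupMr ?(negPf Hx).
have/eqP eqHC : x^-1 *: H == ~: H.
  rewrite eqEcard card_lcoset cardsCs setCK -cardsT oG mul2n -addnn addnK leqnn.
  rewrite andbT; apply/subsetP=> z; rewrite mem_lcoset invgK inE => Hxz.
  by apply: contra Hx => Hz; rewrite -(groupMr _ Hz).
have: y \in x^-1 *: H by rewrite eqHC inE.
by rewrite mem_lcoset invgK => ->.
Qed.

Lemma mem_rcosetI C L w y :
    (forall x y, (x * y \in C) = ((x \in C) == (y \in C))) ->
    (forall x y, (x * y \in L) = ((x \in L) == (y \in L))) ->
  (y \in (C :&: L) :* w) =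
    ((y \in C) == (w \in C)) && ((y \in L) == (w \in L)).
Proof. by move=> CM LM; rewrite mem_rcoset inE CM LM !groupV. Qed.

Lemma connected_Cay_sub (S : {set gT}) H :
  graph_connected (Cay S) -> S \subset H -> H = [set: gT] :> {set gT}.
Proof.
move=> conS /subsetP SH; apply/setP=> x; rewrite inE -(group1 H); apply/esym.
apply: (closed_connect _ (conS 1 x)) => y z /SH Hzy.
by rewrite -[z](mulgKV y) groupMl.
Qed.

Lemma inner_automorphic_conj (S : {set gT}) x g :
  inner_automorphic S -> x \in S -> x ^ g \in S.
Proof.
case=> P /subsetP PG -> /bigcupP[A PA Ax]; apply/bigcupP; exists A => //.
have /imsetP[y _ AE] := PG _ PA; move: Ax; rewrite AE => /imsetP[h _ ->].
by rewrite -conjgM; rewrite memJ_class ?inE.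
Qed.

(** The index runs over 1, ..., q rather than 0, ..., q - 1; as [c ^+ q = 1],
    both ranges cover [<[c]>]. *)
Lemma imset_expg_cycle (c y : gT) q : 0 < q -> c ^+ q = 1 ->
  [set c ^+ i * y | i : 'I_q.+1 & 1 <= i] = <[c]> :* y.
Proof.
move=> q_gt0 cq; apply/setP=> x; rewrite mem_rcoset.
apply/imsetP/idP=> [[i _ ->] | /cycleP[i xE]]; first by rewrite mulgK mem_cycle.
have lt_iq := ltn_pmod i q_gt0.
have xE' : x = c ^+ (i %% q) * y by rewrite (expg_mod i cq) -xE mulgKV.
case: (posnP (i %% q)) => [i0 | i_gt0].
  by exists ord_max; rewrite ?inE //= cq xE' i0.
by exists (Ordinal (ltnW lt_iq : i %% q < q.+1)); rewrite ?inE.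
Qed.

End IndexTwo.

(** * The dihedral group *)

Section Dihedral.
Variables (gT : finGroupType) (n : nat) (a b : gT).
Hypothesis n_gt1 : 1 < n.
Hypothesis dihG : dihedral_presentation n a b.
Local Notation C := <[a]>.
Local Notation E := <[a ^+ 2]>.

(** Two groups with the same presentation are homomorphic images of each
    other. *)
Lemma card_dihedral_presentation : #|[set: gT]| = (2 * n)%N.
Proof.
have [isoG _ _ _ _] := dihG; have isoD := Grp_dihedral n_gt1.
rewrite mul2n -(card_dihedral n_gt1); apply/eqP; rewrite eqn_leq.
by rewrite !leq_homg // ?isoD -?isoG ?homg_refl // isoG -isoD homg_refl.
Qed.

Let b2 : b ^+ 2 = 1. Proof. by case: dihG. Qed.
Let ab : a ^ b = a^-1. Proof. by case: dihG. Qed.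

(** [G] is the product of [C] and [<[b]>], of order at most [n * 2]; so both
    factors are as large as possible and they meet trivially. *)
Let order_ab : #[a] = n /\ b \notin C.
Proof.
have [_ genG an _ _] := dihG.
have nCb : <[b]> \subset 'N(C) by rewrite norms_cycle ab groupV cycle_id.
have oG : #|[set: gT]| = #|C * <[b]>|.
  by rewrite -genG -norm_joinEr // joing_idl joing_idr.
have an_le : #[a] <= n by rewrite dvdn_leq ?order_dvdn ?an // ltnW.
have b_le : #[b] <= 2 by rewrite dvdn_leq ?order_dvdn ?b2.
have := mul_cardG <[a]> <[b]>; rewrite /= -oG card_dihedral_presentation => oCB.
have I_gt0 : 0 < #|C :&: <[b]>| by rewrite cardG_gt0.
have le_2n : #|<[a]>| * #|<[b]>| <= 2 * n by rewrite mulnC leq_mul.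
have I1 : #|C :&: <[b]>| = 1%N.
  apply/eqP; rewrite eqn_leq I_gt0 andbT -(@leq_pmul2l (2 * n)).
    by rewrite -oCB muln1.
  by rewrite muln_gt0 (ltnW n_gt1).
move: oCB; rewrite I1 muln1 => oCB.
have oa : #[a] = n.
  apply/eqP; rewrite eqn_leq an_le -(@leq_pmul2r 2) // [(n * 2)%N]mulnC -oCB.
  by rewrite leq_mul2l b_le orbT.
split=> //; apply/negP=> Cb; move: oCB.
have -> : <[b]> = 1.
  apply/eqP; rewrite trivg_card1 -I1; apply/eqP; congr #|pred_of_set _|.
  by apply/esym/setIidPr; rewrite cycle_subG.
rewrite cards1 muln1 -orderE oa mul2n -addnn -{1}[n]addn0 => /addnI n0.
by move: n_gt1; rewrite -n0.
Qed.

Lemma order_a : #[a] = n. Proof. by case: order_ab. Qed.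

Lemma b_notin_C : b \notin C. Proof. by case: order_ab. Qed.

Let a_n : a ^+ n = 1. Proof. by rewrite -order_a expg_order. Qed.

Lemma cycle_index2 x y : (x * y \in C) = ((x \in C) == (y \in C)).
Proof.
by apply: (@index2_mem _ <[a]>%G); rewrite -orderE order_a card_dihedral_presentation.
Qed.

Lemma conj_reflection c g : c \in C -> g \notin C -> c ^ g = c^-1.
Proof.
move=> Cc Cg; have Cgb : g * b^-1 \in C.
  by rewrite cycle_index2 groupV (negPf Cg) (negPf b_notin_C).
have -> : c ^ g = c ^ b.
  rewrite -[g](mulgKV b) conjgM; congr (_ ^ b); apply/conjg_fixP/commgP.
  exact: (centsP (cycle_abelian a)).
by case/cycleP: Cc => i ->; rewrite conjXg ab expgVn.
Qed.

Lemma reflection_sqr g : g \notin C -> g * g = 1.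
Proof.
move=> Cg; have Cgb : g * b^-1 \in C.
  by rewrite cycle_index2 groupV (negPf Cg) (negPf b_notin_C).
have b1 : b^-1 = b by apply/eqP; rewrite eq_invg_mul; apply/eqP.
have := conj_reflection Cgb b_notin_C.
rewrite conjgE invMg !mulgA mulgKV invgK b1 => /mulgI gV.
by rewrite {2}gV mulgV.
Qed.

(** Conjugating a reflection by a rotation [c] multiplies it by a square,
    [c^-2]. *)
Lemma reflection_class (S : {set gT}) x : inner_automorphic S ->
  x \in S -> x \notin C -> E :* x \subset S.
Proof.
move=> innS Sx Cx; apply/subsetP=> y; rewrite mem_rcoset => /cycleP[j yE].
have -> : y = x ^ (a ^- j).
  rewrite conjgE invgK -[y](mulgKV x) yE -expgM mul2n -addnn expgD -!mulgA.
  congr (_ * _).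
  have := @conj_reflection (a ^- j) x^-1; rewrite !groupV mem_cycle => /(_ isT Cx).
  by rewrite conjgE !invgK mulgA => {1}<-; rewrite mulgKV.
exact: inner_automorphic_conj.
Qed.

Lemma odd_cycle_sqr : odd n -> E = C.
Proof.
move=> on; apply/eqP; rewrite eqEsubset !cycle_subG mem_cycle /=.
apply/cycleP; exists n./2.+1.
have nE : n./2.*2.+1 = n by rewrite -[RHS]odd_double_half on.
by rewrite -expgM mul2n doubleS nE expgS a_n mulg1.
Qed.

(** For even [n] these are the two index-2 subgroups other than [<[a]>], one for
    each class of reflections [x]. *)
Definition reflection_subgroup (x : gT) := (<[a ^+ 2]> <*> <[x]>)%G.

Section Even.
Variable k : nat.
Hypothesis nk : n = (2 * k)%N.
Local Notation L := reflection_subgroup.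

Let k_gt0 : 0 < k. Proof. by move: n_gt1; rewrite nk; case: k. Qed.

Section OneReflection.
Variable x : gT.
Hypothesis Cx : x \notin C.

Lemma card_reflection_subgroup : #|L x| = n.
Proof.
have nEx : <[x]> \subset 'N(E).
  by rewrite norms_cycle conj_reflection ?mem_cycle // groupV cycle_id.
have oE : #|E| = k by rewrite -orderE orderXdiv order_a nk ?dvdn_mulr // mulKn.
have x1 : x != 1 by apply: contraNneq Cx => ->; apply: group1.
have ox : #|<[x]>| = 2.
  by apply: nt_prime_order => //; exact: reflection_sqr.
rewrite /= norm_joinEr // TI_cardMg ?oE ?ox ?nk 1?mulnC //.
apply/trivgP/subsetP=> y; rewrite inE => /andP[/cycleP[i yE] /cycleP[j]].
have -> : x ^+ j = x ^+ odd j.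
  rewrite -{1}(odd_double_half j) expgD -mul2n expgM expgS.
  by rewrite reflection_sqr // expg1n mulg1.
case: (odd j) => [yx|->]; last by rewrite inE.
by case/negP: Cx; rewrite -[x]yx yE -expgM mem_cycle.
Qed.

Lemma reflection_subgroup_index2 y z :
  (y * z \in L x) = ((y \in L x) == (z \in L x)).
Proof.
by apply: index2_mem; rewrite card_reflection_subgroup card_dihedral_presentation.
Qed.

Lemma reflection_in_subgroup : x \in L x.
Proof. by rewrite mem_gen // inE cycle_id orbT. Qed.

Lemma a_notin_reflection_subgroup : a \notin L x.
Proof.
apply: contra Cx => La; have/eqP -> : C == L x.
  by rewrite eqEcard cycle_subG La card_reflection_subgroup -orderE order_a leqnn.
exact: reflection_in_subgroup.
Qed.

Lemma expg_reflection_subgroup i : (a ^+ i \in L x) = ~~ odd i.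
Proof.
elim: i => [|i IHi]; first by rewrite expg0 group1.
rewrite expgS reflection_subgroup_index2 IHi (negPf a_notin_reflection_subgroup).
by rewrite /=; case: (odd i).
Qed.

Lemma cycleI_reflection_subgroup : C :&: L x = E.
Proof.
apply/eqP; rewrite eqEsubset subsetI !cycle_subG mem_cycle /=.
rewrite expg_reflection_subgroup /= andbT; apply/subsetP=> y.
case/setIP=> /cycleP[i ->]; rewrite expg_reflection_subgroup => ei.
by rewrite -(odd_double_half i) (negPf ei) -mul2n expgM mem_cycle.
Qed.

Lemma mem_rcoset_sqr w y :
  (y \in E :* w) = ((y \in C) == (w \in C)) && ((y \in L x) == (w \in L x)).
Proof.
rewrite -cycleI_reflection_subgroup.
exact: (mem_rcosetI _ _ cycle_index2 reflection_subgroup_index2).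
Qed.

Lemma setC_reflection_subgroup w : w \notin C -> w \notin L x ->
  E :* w :|: E :* a = ~: L x.
Proof.
move=> Cw Lw; apply/setP=> y; rewrite in_setU in_setC !mem_rcoset_sqr.
rewrite cycle_id (negPf Cw) (negPf Lw) (negPf a_notin_reflection_subgroup).
by case: (y \in C); case: (y \in L x).
Qed.

End OneReflection.

Let a2k : (a ^+ 2) ^+ k = 1. Proof. by rewrite -expgM -nk. Qed.

Lemma even_reflE : even_refl a b k = E :* b.
Proof.
rewrite -(imset_expg_cycle b k_gt0 a2k).
by apply: eq_imset => i; rewrite expgM.
Qed.

Lemma odd_reflE : odd_refl a b k = E :* (a * b).
Proof.
rewrite -(imset_expg_cycle (a * b) k_gt0 a2k).
by apply: eq_imset => i; rewrite expgD expgM mulgA.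
Qed.

Lemma odd_rotE : odd_rot a k = E :* a.
Proof.
rewrite -(imset_expg_cycle a k_gt0 a2k).
by apply: eq_imset => i; rewrite expgD expgM.
Qed.

(* For 1 <= j <= k the exponent 2j + 1 is at most n + 1, so it is congruent to
   k modulo n only when it equals k. *)
Lemma odd_rot_but_kE : 3 <= k -> odd_rot_but_k a k = odd_rot a k :\ a ^+ k.
Proof.
move=> k_ge3; have aE (j : 'I_k.+1) : 1 <= j ->
    (a ^+ (2 * j + 1) == a ^+ k) = (2 * j + 1 == k)%N.
  move=> j_gt0; have le_jk : j <= k := leq_ord j.
  have lt_kn : k < n by rewrite nk -{1}[k]mul1n ltn_pmul2r.
  rewrite eq_expg_mod_order order_a [k %% n]modn_small //.
  case: (ltnP (2 * j + 1) n) => [lt_jn | le_nj]; first by rewrite modn_small.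
  have jn : (2 * j + 1 = 1 + n)%N.
    have /eqP -> : j == k :> nat.
      rewrite eqn_leq le_jk /= leqNgt; apply: contraL le_nj => lt_jk.
      by rewrite -ltnNge nk addn1 !mul2n -doubleS leq_double.
    by rewrite addnC nk.
  rewrite jn modnDr modn_small // ltn_eqF ?(ltnW k_ge3) //.
  by rewrite gtn_eqF // add1n ltnW.
apply/setP=> y; rewrite in_setD1; apply/imsetP/andP=> [[j] | [yk /imsetP[j]]].
  rewrite inE => /andP[j1 jk] ->; rewrite aE // jk; split=> //.
  by apply/imsetP; exists j; rewrite ?inE.
rewrite inE => j1 yE; exists j => //; rewrite inE j1 /=.
by rewrite -aE // -yE.
Qed.

Lemma ab_notin_C : a * b \notin C.
Proof. by rewrite cycle_index2 cycle_id (negPf b_notin_C). Qed.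

Lemma even_refl_odd_rot : even_refl a b k :|: odd_rot a k = ~: L (a * b).
Proof.
rewrite even_reflE odd_rotE (setC_reflection_subgroup ab_notin_C b_notin_C) //.
have := reflection_in_subgroup (a * b).
rewrite reflection_subgroup_index2 ?ab_notin_C //.
rewrite (negPf (a_notin_reflection_subgroup ab_notin_C)).
by case: (b \in _).
Qed.

Lemma odd_refl_odd_rot : odd_refl a b k :|: odd_rot a k = ~: L b.
Proof.
rewrite odd_reflE odd_rotE (setC_reflection_subgroup b_notin_C ab_notin_C) //.
rewrite reflection_subgroup_index2 ?b_notin_C // reflection_in_subgroup.
by rewrite (negPf (a_notin_reflection_subgroup b_notin_C)).
Qed.

Lemma setU_odd_rot_but_k w : 3 <= k -> w \notin C ->
  E :* w :|: odd_rot_but_k a k = (E :* w :|: odd_rot a k) :\ a ^+ k.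
Proof.
move=> k_ge3 Cw; rewrite odd_rot_but_kE //; apply/setP=> y.
rewrite in_setD1 !in_setU in_setD1; case: eqP => [->|] //=; rewrite orbF.
apply: contraNF Cw; rewrite mem_rcoset => /(subsetP (cycleX a 2)).
by rewrite cycle_index2 mem_cycle groupV.
Qed.

End Even.

Lemma all_reflE : all_refl a b n = ~: C.
Proof.
rewrite [LHS](imset_expg_cycle b (ltnW n_gt1) a_n).
apply/setP=> y; rewrite mem_rcoset in_setC cycle_index2 groupV.
by rewrite (negPf b_notin_C) eqbF_neg.
Qed.

(** * The neighbourhoods of the identity that can occur *)

(** Connectedness gives a reflection [x] in [S], and then [S] contains its
    whole class [E :* x].  If [S] contains all reflections, [x] has no common
    non-neighbour with [1].  Otherwise [n] is even, [S] misses the other class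
    of reflections, and the two index-2 subgroups [C] and
    [reflection_subgroup (a * x)] satisfy the hypotheses of
    [neighbours_bipartite]. *)
Lemma neighbour_set_cases (S : {set gT}) :
    cayley_set S -> inner_automorphic S -> graph_connected (Cay S) ->
    two_distance_transitive (Cay S) ->
  (exists2 H : {group gT}, H \proper [set: gT] & H \subset C /\ S = ~: H) \/
  exists (k : nat) (x : gT), [/\ n = (2 * k)%N, x \notin C &
    S = ~: reflection_subgroup x \/
    exists z, [/\ 3 <= k, odd k, z \notin reflection_subgroup x, z * z = 1 &
                  S = ~: reflection_subgroup x :\ z]].
Proof.
move=> cayS innS conS trS.
have [x Sx Cx] : exists2 x, x \in S & x \notin C.
  apply/subsetPn; apply/negP=> /(connected_Cay_sub conS) CT.
  by have := b_notin_C; rewrite CT inE.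
have Ex := subsetP (reflection_class innS Sx Cx).
have allS : (forall y, y \notin C -> y \in S) ->
    exists2 H : {group gT}, H \proper [set: gT] & H \subset C /\ S = ~: H.
  move=> allS; have NC : ~: S \subset C.
    by apply/subsetP=> y; rewrite inE; apply: contraR; apply: allS.
  have N0 : ~: S :&: (~: S) :* x = set0.
    apply/setP=> y; rewrite in_set0 in_setI mem_rcoset.
    apply/negP=> /andP[/(subsetP NC) Cy /(subsetP NC)].
    by rewrite cycle_index2 Cy groupV (negPf Cx).
  exists (Group (group_set_nonneighbours cayS trS Sx N0)); last by rewrite setCK.
  by rewrite properT; apply/negP=> /eqP/setP/(_ x); rewrite !inE Sx.
case: (boolP (odd n)) => [on | en].
  left; apply: allS => y Cy; apply: Ex.
  by rewrite mem_rcoset odd_cycle_sqr // cycle_index2 groupV (negPf Cx) (negPf Cy).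
have nk : n = (2 * n./2)%N by rewrite -[LHS]odd_double_half (negPf en) mul2n.
set k := n./2 in nk; pose w := a * x.
have Cw : w \notin C by rewrite cycle_index2 cycle_id (negPf Cx).
pose L := reflection_subgroup w.
have Lw : w \in L := reflection_in_subgroup w.
have CM := cycle_index2.
have LM := reflection_subgroup_index2 nk Cw.
have La : a \notin L := a_notin_reflection_subgroup nk Cw.
have Lx : x \notin L by move: Lw; rewrite LM (negPf La); case: (x \in L).
have class_x y : y \notin C -> y \notin L -> y \in E :* x.
  move=> Cy Ly; rewrite (mem_rcoset_sqr nk Cw) (negPf Cy) (negPf Ly).
  by rewrite (negPf Cx) (negPf Lx).
have class_w y z : y \notin C -> y \in L -> z \notin C -> z \in L -> y \in E :* z.
  by move=> Cy Ly Cz Lz; rewrite (mem_rcoset_sqr nk Cw) (negPf Cy) (negPf Cz) Ly Lz.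
case: (boolP (w \in S)) => Sw.
  left; apply: allS => y Cy; case: (boolP (y \in L)) => Ly.
    exact: (subsetP (reflection_class innS Sw Cw)) (class_w _ _ Cy Ly Cw Lw).
  exact/Ex/class_x.
right; exists k, w; split=> //.
have subS y : y \notin C -> y \notin L -> y \in S by move=> Cy Ly; apply/Ex/class_x.
have Ssub y : y \in S -> y \notin C -> y \notin L.
  move=> Sy Cy; apply: contra Sw => Ly.
  exact: (subsetP (reflection_class innS Sy Cy)) (class_w _ _ Cw Lw Cy Ly).
have [r Sr Lxr] : exists2 r, r \in S & r \notin reflection_subgroup x.
  apply/subsetPn; apply/negP=> /(connected_Cay_sub conS) LT.
  by have := a_notin_reflection_subgroup nk Cx; rewrite LT inE.
have E_Lx : E \subset reflection_subgroup x := joing_subl _ _.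
have Cr : r \in C.
  apply: contraR Lxr => Cr; have := class_x r Cr (Ssub r Sr Cr).
  rewrite mem_rcoset => /(subsetP E_Lx).
  by rewrite groupMr ?groupV ?reflection_in_subgroup.
have CLE := cycleI_reflection_subgroup nk Cw.
have Lr : r \notin L.
  by apply: contra Lxr => Lr; apply: (subsetP E_Lx); rewrite -CLE inE Cr.
have [-> | [z [Cz Lz zz SE]]] :=
  neighbours_bipartite cayS trS CM LM Cx Lx Sr Cr Lr subS Ssub; first by left.
have ok : odd k.
  have /cycleP[i zE] := Cz; move: Lz; rewrite zE (expg_reflection_subgroup nk Cw) negbK.
  apply: dvdn_odd; rewrite -(@dvdn_pmul2l 2) // -nk mul2n -addnn -order_a order_dvdn.
  by rewrite expgD -zE zz.
right; exists z; split=> //; rewrite ltn_neqAle; apply/andP; split.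
  by apply: contraTneq ok => <-.
rewrite ltn_neqAle odd_gt0 // andbT; apply/eqP=> k1.
(* If k = 1, then C :&: L is trivial and the two elements [r] and [z] of
   C :\: L coincide. *)
have: r * z \in C :&: L by rewrite inE CM LM Cr Cz (negPf Lr) (negPf Lz).
rewrite CLE; have -> : a ^+ 2 = 1 by move: a_n; rewrite nk -k1.
rewrite cycle1 inE -zz => /eqP/mulIg rz.
by move: Sr; rewrite rz SE !inE eqxx.
Qed.

End Dihedral.

Theorem corollary1p3 (gT : finGroupType) (n : nat) (a b : gT) (S : {set gT}) :
  2 <= n ->
  dihedral_presentation n a b ->
  cayley_set S ->
  inner_automorphic S ->
  graph_connected (Cay S) ->
  (two_distance_transitive (Cay S) <->
     [\/ graph_iso (Cay S) (@Knn n),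
         (exists k : nat, [/\ n = (2 * k)%N, 3 <= k & odd k]) /\
           graph_iso (Cay S) (@Knn_minus_nK2 n),
         graph_iso (Cay S) (@complete_graph (2 * n)) |
         exists (m t : nat) (H : {group gT}),
           [/\ 3 <= m, 2 <= t, (m * t = 2 * n)%N,
               H \subset <[a]> /\ #|H| = t &
               graph_iso (Cay S) (@Kmulti m t)]])
  /\
  [/\ (* (i) *)
      graph_iso (@Knn n) (Cay (all_refl a b n)) /\
      (forall k : nat, n = (2 * k)%N ->
         graph_iso (@Knn n) (Cay (even_refl a b k :|: odd_rot a k)) /\
         graph_iso (@Knn n) (Cay (odd_refl a b k :|: odd_rot a k))),
      (* (ii) *)
      (forall k : nat, n = (2 * k)%N -> 3 <= k -> odd k ->
         graph_iso (@Knn_minus_nK2 n)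
           (Cay (even_refl a b k :|: odd_rot_but_k a k)) /\
         graph_iso (@Knn_minus_nK2 n)
           (Cay (odd_refl a b k :|: odd_rot_but_k a k))),
      (* (iii) *)
      graph_iso (@complete_graph (2 * n)) (Cay ([set: gT] :\ 1)) &
      (* (iv) *)
      (forall (m t : nat) (H : {group gT}),
         3 <= m -> 2 <= t -> (m * t = 2 * n)%N ->
         H \subset <[a]> -> #|H| = t ->
         (forall L : {group gT}, L \subset <[a]> -> #|L| = t -> L = H) /\
         graph_iso (@Kmulti m t) (Cay ([set: gT] :\: H)))].
Proof.
move=> n_gt1 dihG cayS innS conS.
have n_gt0 : 0 < n := ltnW n_gt1.
have oG := card_dihedral_presentation n_gt1 dihG.
have oC : #|<[a]>| = n by rewrite -orderE (order_a n_gt1 dihG).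
have CM := cycle_index2 n_gt1 dihG.
split; last split.
- split=> [trS | ].
    have [[H Hproper [HC SE]] | [k [x [nk Cx SE]]]] :=
      neighbour_set_cases n_gt1 dihG cayS innS conS trS.
      have Hindex : (#|[set: gT] : H| * #|H|)%N = (2 * n)%N.
        by rewrite mulnC Lagrange ?subsetT.
      have index_gt1 : 1 < #|[set: gT] : H|.
        by rewrite indexg_gt1 properE in Hproper *; case/andP: Hproper.
      have [H1 | H_gt1] := leqP #|H| 1.
        constructor 3; rewrite SE -setTD.
        have -> : H = 1 :> {set gT} by apply/eqP; rewrite trivg_card_le1.
        exact: Cay_complete.
      move: index_gt1; rewrite leq_eqVlt => /orP[/eqP index2 | index_gt2].
        constructor 1; rewrite SE; apply: Cay_setC_Knn => //.
          by apply/eqP; rewrite -(@eqn_pmul2l 2) // -Hindex -index2.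
        by apply: index2_mem; rewrite oG -Hindex -index2.
      constructor 4; exists #|[set: gT] : H|, #|H|, H; split=> //.
      by rewrite SE -setTD; apply: Cay_setC_Kmulti; rewrite // Hindex.
    have oL := card_reflection_subgroup n_gt1 dihG nk Cx.
    have LM := reflection_subgroup_index2 n_gt1 dihG nk Cx.
    case: SE => [SE | [z [k_ge3 ok Lz zz SE]]].
      by constructor 1; rewrite SE; apply: Cay_setC_Knn.
    constructor 2; split; first by exists k.
    by rewrite SE; apply: Cay_setC1_Knn_minus_nK2.
  case=> [iso | [_ iso] | iso | [m [t [H [m_ge3 t_ge2 _ _ iso]]]]].
  - apply: iso_two_distance_transitive iso _; first exact: (Knn_simple n).2.
    exact: Knn_two_distance_transitive.
  - apply: iso_two_distance_transitive iso _; first exact: (Knn_minus_nK2_simple n).2.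
    exact: Knn_minus_nK2_two_distance_transitive.
  - apply: iso_two_distance_transitive iso _; first exact: (complete_graph_simple _).2.
    by apply: complete_two_distance_transitive; rewrite muln_gt0.
  apply: iso_two_distance_transitive iso _; first exact: (Kmulti_simple m t).2.
  by apply: Kmulti_two_distance_transitive; apply: ltnW; rewrite // ltnW.
- split; first by apply: graph_iso_sym; rewrite (all_reflE n_gt1 dihG); apply: Cay_setC_Knn.
  move=> k nk; have Cb := b_notin_C n_gt1 dihG.
  have Cab := ab_notin_C n_gt1 dihG.
  rewrite (even_refl_odd_rot n_gt1 dihG nk) (odd_refl_odd_rot n_gt1 dihG nk).
  have oL x (Cx : x \notin <[a]>) := card_reflection_subgroup n_gt1 dihG nk Cx.
  have LM x (Cx : x \notin <[a]>) := reflection_subgroup_index2 n_gt1 dihG nk Cx.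
  by split; apply: graph_iso_sym; apply: Cay_setC_Knn; rewrite ?oL //; apply: LM.
- move=> k nk k_ge3 ok; have Cb := b_notin_C n_gt1 dihG.
  have Cab := ab_notin_C n_gt1 dihG.
  have oL x (Cx : x \notin <[a]>) := card_reflection_subgroup n_gt1 dihG nk Cx.
  have LM x (Cx : x \notin <[a]>) := reflection_subgroup_index2 n_gt1 dihG nk Cx.
  have ak2 : a ^+ k * a ^+ k = 1.
    by rewrite -expgD addnn -mul2n -nk -(order_a n_gt1 dihG) expg_order.
  have Lak x (Cx : x \notin <[a]>) :
      a ^+ k \notin reflection_subgroup a x.
    by rewrite (expg_reflection_subgroup n_gt1 dihG nk Cx) ok.
  rewrite (even_reflE n_gt1 dihG nk) (odd_reflE n_gt1 dihG nk).
  rewrite !(setU_odd_rot_but_k n_gt1 dihG nk k_ge3) //.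
  rewrite -(even_reflE n_gt1 dihG nk) -(odd_reflE n_gt1 dihG nk).
  rewrite (even_refl_odd_rot n_gt1 dihG nk) (odd_refl_odd_rot n_gt1 dihG nk).
  by split; apply: graph_iso_sym; apply: Cay_setC1_Knn_minus_nK2;
    rewrite ?oL ?Lak //; apply: LM.
- by apply: graph_iso_sym; apply: Cay_complete.
move=> m t H m_ge3 t_ge2 mt HC oH; split=> [L LC oL|].
  by apply/val_inj/eqP; rewrite /= (eq_subG_cyclic (cycle_cyclic a)) // oL oH.
by apply: graph_iso_sym; apply: Cay_setC_Kmulti; rewrite // oG.
Qed.
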